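(* Let $r \ge 1$ be odd, $a \ge 1$ be odd, and $t \ge 1$, $s \ge 0$ be integers. Then $$\sigma(r,s,a,t) \ge \begin{cases} r\left\lceil\frac{rt+s}{a}\right\rceil + (t-1)r+1 & \text{if } t \ge 2, \text{ or } t=1 \text{ and } a<tr+s,\\ r & \text{if } t=1 \text{ and } a \ge r+s.\end{cases}$$
   Context: All graphs are finite simple graphs. A $(d,d+s)$-graph is a graph all of whose vertex degrees lie in $\{d, \ldots, d+s\}$. An $(r,r+a)$-factor of $G$ is a spanning subgraph all of whose degrees lie in $\{r,\ldots,r+a\}$; an $(r,r+a)$-factorization of $G$ with $x$ factors is a decomposition of $E(G)$ into $x$ edge-disjoint $(r,r+a)$-factors. $\sigma(r,s,a,t)$ is the least integer such that, whenever $d \ge \sigma(r,s,a,t)$, every simple $(d,d+s)$-graph has an $(r,r+a)$-factorization with $x$ factors for at least $t$ different values of $x$. *)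

(* Defs.v *)
From mathcomp Require Import all_boot all_order all_algebra.
From mathcomp Require Import boolp constructive_ereal.

Set Implicit Arguments.
Unset Strict Implicit.
Unset Printing Implicit Defensive.

Record graph (V : finType) := Graph {
  adj :> rel V;
  adj_sym : symmetric adj;
  adj_irr : irreflexive adj
}.

Definition degree (V : finType) (G : graph V) (v : V) : nat :=
  #|[set w | G v w]|.

(* [degree_graph d s G]: G is a (d, d+s)-graph. *)
Definition degree_graph (d s : nat) (V : finType) (G : graph V) : Prop :=
  forall v : V, d <= degree G v <= d + s.

(* [is_factor r a G F]: F is an (r, r+a)-factor of G; it is spanning because
   F and G share the vertex type V. *)
Definition is_factor (r a : nat) (V : finType) (G F : graph V) : Prop :=
  subrel F G /\ degree_graph r a F.

Definition is_factorization (r a : nat) (V : finType) (G : graph V) (x : nat)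
    (F : 'I_x -> graph V) : Prop :=
  (forall i, is_factor r a G (F i)) /\
  (forall u v, G u v -> exists! i, F i u v).

(* The number x of factors is positive: otherwise every edgeless graph would
   have a factorization with no factors at all. *)
Definition has_factorization (r a : nat) (V : finType) (G : graph V)
    (x : nat) : Prop :=
  0 < x /\ exists F : 'I_x -> graph V, is_factorization r a G F.

Definition has_factorizations (r a t : nat) (V : finType) (G : graph V) :
    Prop :=
  exists xs : seq nat,
    [/\ uniq xs, size xs = t & forall x, x \in xs -> has_factorization r a G x].

Definition sigma_threshold (r s a t m : nat) : Prop :=
  forall d, m <= d -> forall (V : finType) (G : graph V),
    degree_graph d s G -> has_factorizations r a t G.

(* The least threshold, as an extended integer: the value is +oo when there is
   no threshold. *)
Definition sigma (r s a t : nat) : \bar int :=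
  if pselect (exists m, `[< sigma_threshold r s a t m >]) is left ex
  then (Posz (ex_minn ex))%:E else +oo%E.

(* Main.v *)
(** Put k = q + t - 1 with q = ceil ((r t + s) / a), and d = r k.  A graph with
    a vertex of degree d and a vertex of degree d + s admits x factors only if
    q <= x <= k, which is t values; so it suffices to exclude x = k.  With k
    factors, every vertex of degree d has degree exactly r in each factor, so
    each factor has, by parity, an edge leaving every odd set C of such
    vertices.  Since k >= 2, this fails if at most one edge leaves C: take the
    complete graph on d + 1 vertices for d even, and a d-regular graph with a
    bridge for d odd, and add a disjoint complete graph on d + s + 1 vertices. *)
Require Import Defs.
From mathcomp Require Import all_boot all_order all_algebra.
From mathcomp Require Import boolp constructive_ereal.
From mathcomp Require Import zify.

Set Implicit Arguments.
Unset Strict Implicit.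
Unset Printing Implicit Defensive.

Import GRing.Theory Num.Theory.

(** * Degrees in a factorization *)

Lemma degreeE (V : finType) (G : graph V) (v : V) :
  degree G v = \sum_w (G v w : nat).
Proof.
rewrite /degree -sum1dep_card [LHS]big_mkcond; apply: eq_bigr => w _.
by case: (G v w).
Qed.

(** After exchanging the sums, an edge at [v] is counted once, by the only factor containing it, and
    a non-edge never. *)
Lemma degree_factorization (r a x : nat) (V : finType) (G : graph V)
    (F : 'I_x -> graph V) (v : V) :
  is_factorization r a G F -> degree G v = \sum_i degree (F i) v.
Proof.
case=> fac dec; rewrite degreeE.
under [RHS]eq_bigr do rewrite degreeE.
rewrite exchange_big; apply: eq_bigr => w _ /=.
case Gvw: (G v w); last first.
  rewrite big1 // => i _; case Fvw: (F i v w) => //.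
  by have [/(_ v w Fvw)] := fac i; rewrite Gvw.
have [i [Fi uniq_i]] := dec v w Gvw.
rewrite (bigD1 i) //= Fi big1 // => j ji.
by case Fj: (F j v w) => //; rewrite (uniq_i j Fj) eqxx in ji.
Qed.

Lemma factorization_degree_bounds (r a x : nat) (V : finType) (G : graph V)
    (v : V) :
  has_factorization r a G x -> r * x <= degree G v <= (r + a) * x.
Proof.
case=> _ [F facF]; rewrite (degree_factorization v facF).
case: facF => fac _.
have bnd i : r <= degree (F i) v <= r + a by have [_] := fac i.
have sum_const c : \sum_(i < x) c = c * x by rewrite sum_nat_const card_ord mulnC.
rewrite -!sum_const.
by apply/andP; split; apply: leq_sum => i _; case/andP: (bnd i).
Qed.

(** * Parity and edges leaving an odd set *)

(** Every edge inside [C] is counted from both ends; ordering the vertices by [enum_rank] splits the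
    sum into two equal halves. *)
Lemma even_inner_degree_sum (V : finType) (G : graph V) (C : {set V}) :
  ~~ odd (\sum_(u in C) \sum_(v in C) (G u v : nat)).
Proof.
pose below (u v : V) := enum_rank u < enum_rank v.
pose S := \sum_(u in C) \sum_(v in C) (G u v && below u v : nat).
suff -> : \sum_(u in C) \sum_(v in C) (G u v : nat) = S + S by rewrite addnn odd_double.
rewrite {2}/S [X in _ + X]exchange_big -big_split; apply: eq_bigr => u _ /=.
rewrite -big_split; apply: eq_bigr => v _ /=.
rewrite (adj_sym G v u) /below; case Guv: (G u v) => //=.
case: ltngtP => // /ord_inj/enum_rank_inj uv.
by rewrite uv adj_irr in Guv.
Qed.

(** If no edge left [C], the inner degree sum would be the odd number [#|C| * r]. *)
Lemma odd_set_leaving_edge (r : nat) (V : finType) (G : graph V) (C : {set V}) :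
  odd r -> odd #|C| -> {in C, forall u, degree G u = r} ->
  exists u v, [/\ u \in C, v \notin C & G u v].
Proof.
move=> odd_r odd_C deg_C; apply: contrapT => no_edge.
have sumC : \sum_(u in C) \sum_(v in C) (G u v : nat) = #|C| * r.
  rewrite -sum_nat_const; apply: eq_bigr => u uC.
  rewrite -(deg_C u uC) degreeE [RHS](bigID (mem C)) /= [X in _ + X]big1 ?addn0 //.
  move=> v vC; case Guv: (G u v) => //.
  by case: no_edge; exists u, v.
by have := even_inner_degree_sum G C; rewrite sumC oddM odd_C odd_r.
Qed.

(** At most one edge, possibly none: this covers both a bridge and [C] being the whole vertex
    set. *)
Definition single_leaving_edge (V : finType) (G : graph V) (C : {set V}) : Prop :=
  forall u v u' v', u \in C -> v \notin C -> G u v ->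
    u' \in C -> v' \notin C -> G u' v' -> u = u' /\ v = v'.

(** On [C], [k] degrees of at least [r] sum to [r * k], so all equal [r]. By parity two different
    factors each contain an edge leaving [C]; it is the same edge, against disjointness. *)
Lemma no_tight_factorization (r a k : nat) (V : finType) (G : graph V)
    (C : {set V}) :
  odd r -> 1 < k -> odd #|C| -> {in C, forall u, degree G u = r * k} ->
  single_leaving_edge G C -> ~ has_factorization r a G k.
Proof.
move=> odd_r k_gt1 odd_C deg_C single [_ [F facF]].
have [fac dec] := facF.
have deg_F i : {in C, forall u, degree (F i) u = r}.
  move=> u uC; have := degree_factorization u facF; rewrite deg_C //.
  have ge_r j : r <= degree (F j) u by have [_ /(_ u)/andP[]] := fac j.
  have -> : r * k = \sum_(j < k) r by rewrite sum_nat_const card_ord mulnC.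
  move/eqP; rewrite (leqif_sum (fun j _ => leqif_eq (ge_r j))).
  by move/forallP/(_ i)/eqP.
pose i0 := Ordinal (ltnW k_gt1); pose i1 := Ordinal k_gt1.
have [u0 [v0 [u0C v0C F0]]] := odd_set_leaving_edge odd_r odd_C (deg_F i0).
have [u1 [v1 [u1C v1C F1]]] := odd_set_leaving_edge odd_r odd_C (deg_F i1).
have G0 : G u0 v0 by have [/(_ _ _ F0)] := fac i0.
have G1 : G u1 v1 by have [/(_ _ _ F1)] := fac i1.
have [eu ev] := single _ _ _ _ u0C v0C G0 u1C v1C G1.
rewrite -{}eu -{}ev in F1.
have [j [_ uniq_j]] := dec _ _ G0.
by have := uniq_j _ F1; rewrite (uniq_j _ F0) => /(congr1 val).
Qed.

(** * Complete graphs and disjoint unions *)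

Section CompleteGraph.

Variable V : finType.

Definition complete_adj : rel V := fun u v => u != v.

Fact complete_sym : symmetric complete_adj.
Proof. by move=> u v; rewrite /complete_adj eq_sym. Qed.

Fact complete_irr : irreflexive complete_adj.
Proof. by move=> u; rewrite /complete_adj eqxx. Qed.

Definition complete : graph V := Graph complete_sym complete_irr.

Lemma degree_complete v : degree complete v = #|V|.-1.
Proof.
rewrite /degree -(cardC1 v) cardsE.
by apply: eq_card => w; rewrite !inE [in LHS]unfold_in /= /complete_adj eq_sym.
Qed.

End CompleteGraph.

Section DisjointUnion.

Variables (V W : finType) (G : graph V) (H : graph W).

Definition union_adj : rel (V + W) := fun x y =>
  match x, y with
  | inl u, inl v => G u v
  | inr u, inr v => H u v
  | _, _ => false
  end.

Fact union_sym : symmetric union_adj.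
Proof. by case=> u [] v //=; rewrite adj_sym. Qed.

Fact union_irr : irreflexive union_adj.
Proof. by case=> u /=; rewrite adj_irr. Qed.

Definition disjoint_union : graph (V + W)%type := Graph union_sym union_irr.

Lemma degree_union_inl v : degree disjoint_union (inl v) = degree G v.
Proof. by rewrite !degreeE big_sumType /= [X in _ + X]big1 // addn0. Qed.

Lemma degree_union_inr w : degree disjoint_union (inr w) = degree H w.
Proof. by rewrite !degreeE big_sumType /= [X in X + _]big1. Qed.

End DisjointUnion.

(** * A regular graph of odd degree with a bridge *)

Section BridgeGraph.

Variable m : nat.

Let T := option ('I_m.+1 * bool).

(* Reflexive complement of one side of the bridge: a path through [None] on
   three vertices and a perfect matching of the others. *)
Definition nonadjacent : rel T := fun x y =>
  match x, y with
  | None, None => true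
  | None, Some (j, _) => j == ord0
  | Some (i, _), None => i == ord0
  | Some (i, b), Some (j, c) => (i == j) && ((b == c) || (i != ord0))
  end.

Definition bridge_adj : rel (bool * T) := fun x y =>
  if x.1 == y.1 then ~~ nonadjacent x.2 y.2
  else (x.2 == None) && (y.2 == None).

Fact nonadjacent_sym : symmetric nonadjacent.
Proof.
by case=> [[i b]|] [[j c]|] //=; rewrite eq_sym (eq_sym b); case: eqP => [->|].
Qed.

Fact bridge_sym : symmetric bridge_adj.
Proof.
by move=> x y; rewrite /bridge_adj eq_sym nonadjacent_sym andbC.
Qed.

Fact bridge_irr : irreflexive bridge_adj.
Proof. by case=> b [[i c]|]; rewrite /bridge_adj /= !eqxx. Qed.

Definition bridge : graph (bool * T)%type := Graph bridge_sym bridge_irr.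

Lemma card_side : #|{: T}| = m.*2.+3.
Proof. by rewrite card_option card_prod card_ord card_bool muln2 doubleS. Qed.

Lemma card_nonadjacent x : #|[set y | nonadjacent x y]| = 2 + (x == None).
Proof.
case: x => [[i b]|] /=.
  (* The only other vertex nonadjacent to [Some (i, b)]: the middle of the path if [i] is [ord0],
     the matched partner otherwise. *)
  pose z : T := if i == ord0 then None else Some (i, ~~ b).
  have -> : [set y | nonadjacent (Some (i, b)) y] = [set Some (i, b); z].
    apply/setP=> -[[j c]|]; rewrite !inE /z /=; case: (eqVneq i ord0) => //= _.
    - by rewrite !orbF (inj_eq Some_inj) xpair_eqE (eq_sym j) (eq_sym c).
    - rewrite !(inj_eq Some_inj) !xpair_eqE (eq_sym j) orbT andbT.
      by case: (i == j); case: {z} b c => -[].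
  rewrite cards2 /z; case: (i == ord0) => //.
  by rewrite (inj_eq Some_inj) xpair_eqE eqxx; case: {z} b.
have -> : [set y | nonadjacent None y] =
    [set None; Some (ord0, true); Some (ord0, false)].
  apply/setP=> -[[j c]|]; rewrite !inE //= !(inj_eq Some_inj) !xpair_eqE.
  by case: (j == ord0); case: c.
by rewrite -setUA cardsU1 cards2 !inE.
Qed.

(** Within its side of [m.*2.+3] vertices, a vertex misses itself and one other; [None] misses one
    more, which the bridge makes up for. *)
Lemma degree_bridge x : degree bridge x = m.*2.+1.
Proof.
case: x => b x; rewrite degreeE.
rewrite -(pair_bigA _ (fun c y => (bridge (b, x) (c, y) : nat))) /=.
rewrite (bigD1 b) //= (bigD1 (~~ b)) /=; last by case: b.
rewrite [X in _ + (_ + X)]big1 => [|c]; last by case: b c => -[].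
rewrite addn0.
have -> : \sum_y (bridge_adj (b, x) (b, y) : nat) = m.*2.+3 - (2 + (x == None)).
  rewrite -card_side -(card_nonadjacent x).
  have -> : #|{: T}| - #|[set y | nonadjacent x y]| = #|~: [set y | nonadjacent x y]|.
    by rewrite [RHS]cardsCs setCK.
  rewrite -sum1_card [RHS]big_mkcond; apply: eq_bigr => y _.
  by rewrite !inE /bridge_adj /= eqxx; case: nonadjacent.
have -> : \sum_y (bridge_adj (b, x) (~~ b, y) : nat) = (x == None).
  rewrite (bigD1 None) //= big1 => [|y /negPf yN].
    by rewrite /bridge_adj /=; case: b; rewrite andbT addn0.
  by rewrite /bridge_adj /= yN andbF; case: b.
by case: (x == None); lia.
Qed.

Lemma bridge_single_leaving_edge :
  single_leaving_edge bridge [set x | x.1].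
Proof.
move=> [b x] [c y] [b' x'] [c' y']; rewrite !inE /= /bridge_adj /=.
case: b => // _; case: c => // _ /andP[/eqP-> /eqP->].
by case: b' => // _; case: c' => // _ /andP[/eqP-> /eqP->].
Qed.

Lemma odd_bridge_side : odd #|[set x : bool * T | x.1]|.
Proof.
have -> : [set x : bool * T | x.1] = setX [set true] setT.
  by apply/setP=> -[b x]; rewrite !inE andbT; case: b.
by rewrite cardsX cards1 cardsT card_side mul1n /= odd_double.
Qed.

End BridgeGraph.

(** * The extremal graph *)

Lemma exists_regular_single_leaving_edge (d : nat) :
  exists (V : finType) (G : graph V) (C : {set V}),
    [/\ forall v, degree G v = d, odd #|C| & single_leaving_edge G C].
Proof.
case odd_d: (odd d).
  exists (bool * option ('I_(d./2).+1 * bool))%type, (bridge d./2), [set x | x.1].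
  split; [|exact: odd_bridge_side|exact: bridge_single_leaving_edge].
  by move=> v; rewrite degree_bridge -[RHS]odd_double_half odd_d.
exists 'I_d.+1, (complete 'I_d.+1), setT; split=> [v||u v u' v' _].
- by rewrite degree_complete card_ord.
- by rewrite cardsT card_ord /= odd_d.
- by rewrite inE.
Qed.

(** A vertex of degree [r * k] gives [x <= k], one of degree [r * k + s] gives the second
    inequality, and parity excludes [x = k]. *)
Lemma exists_few_factorizations (r s a k : nat) : odd r -> 1 < k ->
  exists (V : finType) (G : graph V),
    degree_graph (r * k) s G /\
    forall x, has_factorization r a G x ->
      x < k /\ r * k + s <= (r + a) * x.
Proof.
move=> odd_r k_gt1; set d := r * k.
have [V [G [C [deg_G odd_C single]]]] := exists_regular_single_leaving_edge d.
pose K := complete 'I_(d + s).+1; pose U := disjoint_union G K.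
have deg_K w : degree K w = d + s by rewrite degree_complete card_ord.
have mem_inl (v : V) : (inl v \in @inl V 'I_(d + s).+1 @: C) = (v \in C).
  by rewrite mem_imset //; apply: inl_inj.
exists (V + 'I_(d + s).+1)%type, U; split=> [[v|w]|x fac_x].
- by rewrite degree_union_inl deg_G leqnn leq_addr.
- by rewrite degree_union_inr deg_K leqnn leq_addr.
have r_gt0 : 0 < r by case: (r) odd_r.
have [v _] : exists v, v \in C by apply/set0Pn; rewrite -card_gt0; case: #|C| odd_C.
have /andP[x_le _] := factorization_degree_bounds (inl v) fac_x.
have /andP[_ x_ge] := factorization_degree_bounds (inr ord0) fac_x.
rewrite degree_union_inl deg_G leq_pmul2l // in x_le.
rewrite degree_union_inr deg_K in x_ge.
split=> //; rewrite ltn_neqAle x_le andbT; apply/eqP=> xk; rewrite {}xk in fac_x.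
apply: (@no_tight_factorization r a k _ U (inl @: C)) fac_x => //.
- by rewrite card_imset //; apply: inl_inj.
- by move=> _ /imsetP[u _ ->]; rewrite degree_union_inl deg_G.
move=> _ y1 _ y2 /imsetP[u1 u1C ->] + + /imsetP[u2 u2C ->].
case: y1 y2 => [v1|?] [v2|?] // v1C e1 v2C e2.
rewrite !mem_inl in v1C v2C.
by have [-> ->] := single _ _ _ _ u1C v1C e1 u2C v2C e2.
Qed.

(** * Thresholds, the ceiling and the lower bound *)

(** Without any threshold [sigma] is [+oo] and the bound is trivial, so only natural thresholds have
    to be bounded below. *)
Lemma sigma_ge (r s a t n : nat) :
  (forall m, sigma_threshold r s a t m -> n <= m) ->
  ((n%:Z)%R%:E <= sigma r s a t)%E.
Proof.
move=> n_le; rewrite /sigma; case: pselect => [ex|_]; last exact: leey.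
by rewrite lee_fin lez_nat; case: ex_minnP => m /asboolP/n_le.
Qed.

(** Replaces the rational ceiling by the least natural [q] with [n <= a * q]. *)
Lemma ceil_ratio (n a : nat) : 0 < a ->
  exists q : nat, [/\ Num.ceil (n%:Q / a%:Q)%R = q%:Z%R, n <= a * q &
    forall x, n <= a * x -> q <= x].
Proof.
move=> a_gt0; exists ((n + a.-1) %/ a); split; [|lia|].
  apply: ceil_def; rewrite ltr_pdivlMr ?ler_pdivrMr ?ltr0z //.
  by rewrite -!intrM ltr_int ler_int; nia.
nia.
Qed.

Theorem theorem27 (r s a t : nat)
    (r_ge1 : 1 <= r) (r_odd : odd r) (a_ge1 : 1 <= a) (a_odd : odd a)
    (t_ge1 : 1 <= t) :
  ((2 <= t \/ (t = 1 /\ a < t * r + s)) ->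
   ((r%:Z * Num.ceil ((r * t + s)%N%:Q / a%:Q) + (t%:Z - 1) * r%:Z + 1)%R%:E
      <= sigma r s a t)%E) /\
  ((t = 1 /\ r + s <= a) ->
   ((r%:Z)%:E <= sigma r s a t)%E).
Proof.
split=> [large|[t1 _]]; last first.
  (* The complete graph on [r] vertices has degree [r.-1], too small for even one factor, and
     [x = 0] is excluded by definition. *)
  apply: sigma_ge => m thr; rewrite leqNgt; apply/negP=> m_lt.
  have deg_K (v : 'I_r) : degree (complete 'I_r) v = r.-1.
    by rewrite degree_complete card_ord.
  have m_le : m <= r.-1 by lia.
  have deg_K_s : degree_graph r.-1 s (complete 'I_r).
    by move=> v; rewrite deg_K leqnn leq_addr.
  have [xs [_ size_xs fac]] := thr _ m_le _ _ deg_K_s.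
  case: xs size_xs fac => [|x xs _ /(_ x (mem_head _ _)) fac_x]; first by rewrite t1.
  have := factorization_degree_bounds (Ordinal r_ge1) fac_x.
  rewrite deg_K; case: fac_x => x_gt0 _; nia.
have [q [-> q_ge q_min]] := ceil_ratio (r * t + s) a_ge1.
pose k := q + t.-1.
have -> : (r%:Z * q%:Z + (t%:Z - 1) * r%:Z + 1)%R = ((r * k).+1%:Z)%R.
  by rewrite /k; nia.
(* For [t >= 2], [q >= 1] suffices; for [t = 1], [a < r + s] forces [q >= 2]. *)
have k_gt1 : 1 < k by rewrite /k; nia.
apply: sigma_ge => m thr; rewrite ltnNge; apply/negP=> m_le.
have [V [G [deg_G few]]] := exists_few_factorizations s a r_odd k_gt1.
have [xs [uniq_xs size_xs fac]] := thr _ m_le V G deg_G.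
have sub_xs (x : nat) : x \in xs -> x \in iota q t.-1.
  move=> /fac/few[x_lt x_ge]; rewrite mem_iota x_lt andbT.
  rewrite leqNgt; apply/negP=> x_lt_q.
  (* As [x <= q - 1], subtracting [r * x] from [r * k + s <= (r + a) * x] leaves
     [r * t + s <= a * x]. *)
  have : q <= x by apply: q_min; rewrite /k in x_ge; nia.
  by rewrite leqNgt x_lt_q.
(* Now [t] distinct values would lie among the [t - 1] integers from [q] to [k - 1]. *)
have := uniq_leq_size uniq_xs sub_xs; rewrite size_iota size_xs; lia.
Qed.
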